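(* Every recursive equation $\mathbf{v} \doteq \mathbf{F}$ has a unique solution $\mathbf{G}$, i.e. there is exactly one formula $\mathbf{G}$ with $\mathbf{G} = \mathbf{F}[\mathbf{G}/\mathbf{v}]$. Furthermore, $\mathbf{G}$ is ill-founded.
   Context: Positions are finite sequences of natural numbers; $\langle\rangle$ is the empty position, $p\star q$ is concatenation, $|p|$ is the length, and $p \sqsubseteq q$ means $q = p \star t$ for some position $t$ ($p \sqsubset q$ if moreover $t \neq \langle\rangle$). For a set $L$, a tree labeled by $L$ is a partial function $T$ from positions to $L$ whose domain $\mathrm{dom}(T)$ contains $\langle\rangle$ and is closed under restriction ($p \in \mathrm{dom}(T)$, $q \sqsubseteq p$ imply $q \in \mathrm{dom}(T)$). A position $p\in\mathrm{dom}(T)$ is a leaf if no proper extension of $p$ is in $\mathrm{dom}(T)$. $T$ is ill-founded if there is $f:\mathbb{N}\to\mathrm{dom}(T)$ with $f(n)\sqsubset f(n+1)$ for all $n$. For $p \in \mathrm{dom}(T)$, the subtree $T_p$ has domain $\{q : p\star q\in\mathrm{dom}(T)\}$ and $T_p(q)=T(p\star q)$. Positive propositional variables are $\mathbf{v} = (+,v)$ and negated ones $\neg\mathbf{v}=(-,v)$, $v\in\mathbb{N}$. A formula is a tree labeled by $\{\vee,\wedge\}\cup\{\text{positive variables}\}\cup\{\text{negated variables}\}$ in which every position labeled by a variable is a leaf. A formula whose root is labeled by a variable is an atom (its domain is $\{\langle\rangle\}$, written $\mathbf{v}$ or $\neg\mathbf{v}$); otherwise it is compound. The negation $\neg\mathbf{F}$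 has the same domain and swaps $\mathbf{v}\leftrightarrow\neg\mathbf{v}$ and $\vee\leftrightarrow\wedge$ at every position. Substitution: for formulas $\mathbf{F},\mathbf{G}$ and a positive variable $\mathbf{v}$, let $R=\{r\in\mathrm{dom}(\mathbf{F}) : \mathbf{F}(r)\in\{\mathbf{v},\neg\mathbf{v}\}\}$ and $S=\mathrm{dom}(\mathbf{F})\setminus R$. Then $\mathbf{F}[\mathbf{G}/\mathbf{v}]$ has domain $S\cup\{r\star q : r\in R, q\in\mathrm{dom}(\mathbf{G})\}$, with value $\mathbf{F}(p)$ if $p\in S$, $\mathbf{G}(q)$ if $p=r\star q$ with $\mathbf{F}(r)=\mathbf{v}$, and $(\neg\mathbf{G})(q)$ if $p=r\star q$ with $\mathbf{F}(r)=\neg\mathbf{v}$. A recursive equation $\mathbf{v}\doteq\mathbf{F}$ is a pair consisting of a positive atom $\mathbf{v}$ and a compound formula $\mathbf{F}$ such that $\mathbf{F}(p)\in\{\mathbf{v},\neg\mathbf{v}\}$ for some $p\in\mathrm{dom}(\mathbf{F})$. A solution is a formula $\mathbf{G}$ with $\mathbf{G}=\mathbf{F}[\mathbf{G}/\mathbf{v}]$. *)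

(* Defs.v *)
From mathcomp Require Import all_boot.

Set Implicit Arguments.
Unset Strict Implicit.
Unset Printing Implicit Defensive.

(* Concatenation of positions is [++], length is [size], and the (non-strict)
   extension order is the library's [prefix]. *)
Definition position := seq nat.

Definition sprefix (p q : position) : Prop :=
  exists2 t : position, t <> [::] & q = p ++ t.

Lemma sprefix_cat (p t : position) : t <> [::] -> sprefix p (p ++ t).
Proof. by exists t. Qed.

(* A partial function is a total function to [option L]; its domain is the set
   of positions that are not sent to [None]. *)
Record tree (L : Type) := Tree {
  tree_fun :> position -> option L;
  tree_root : tree_fun [::];
  tree_closed : forall p q : position, tree_fun p -> prefix q p -> tree_fun q
}.

Definition dom (L : Type) (T : tree L) : pred position := fun p => T p.

Definition leaf (L : Type) (T : tree L) (p : position) : Prop :=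
  dom T p /\ forall q : position, sprefix p q -> ~~ dom T q.

Definition ill_founded (L : Type) (T : tree L) : Prop :=
  exists2 f : nat -> position,
    forall n, dom T (f n) & forall n, sprefix (f n) (f n.+1).

Inductive label := Or | And | Pos of nat | Neg of nat.

Definition is_var (l : option label) : bool :=
  match l with Some (Pos _) | Some (Neg _) => true | _ => false end.

(* The value [l] is the variable [v] or its negation. *)
Definition is_var_of (v : nat) (l : option label) : bool :=
  match l with Some (Pos w) | Some (Neg w) => w == v | _ => false end.

Record formula := Formula {
  formula_tree :> tree label;
  formula_leaf : forall p : position, is_var (formula_tree p) -> leaf formula_tree p
}.

Definition atomic (F : formula) : Prop := is_var (F [::]).
Definition compound (F : formula) : Prop := ~ atomic F.

Definition neg_label (l : label) : label :=
  match l with Or => And | And => Or | Pos v => Neg v | Neg v => Pos v end.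

Definition neg_fun (F : formula) (p : position) : option label :=
  omap neg_label (F p).

Lemma neg_fun_dom (F : formula) p : neg_fun F p = F p :> bool.
Proof. by rewrite /neg_fun; case: (F p). Qed.

Lemma neg_fun_root F : neg_fun F [::].
Proof. by rewrite neg_fun_dom tree_root. Qed.

Lemma neg_fun_closed F p q : neg_fun F p -> prefix q p -> neg_fun F q.
Proof. by rewrite !neg_fun_dom; apply: tree_closed. Qed.

Definition neg_tree (F : formula) : tree label :=
  Tree (neg_fun_root F) (@neg_fun_closed F).

Lemma neg_tree_leaf F p : is_var (neg_tree F p) -> leaf (neg_tree F) p.
Proof.
move=> vp; have /formula_leaf[Fp leafp]: is_var (F p).
  by move: vp; rewrite /= /neg_fun; case: (F p) => [[]|].
split=> [|q pq]; first by rewrite /dom /= neg_fun_dom.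
by rewrite /dom /= neg_fun_dom; apply: leafp.
Qed.

Definition neg (F : formula) : formula := Formula (@neg_tree_leaf F).

(* [subst_fun F G v p]: a position [p] has at most one prefix [r] at which [F]
   is labelled by [v] or its negation, since such an [r] is a leaf of [F]; the
   lemmas [subst_fun_out], [subst_fun_pos], [subst_fun_neg] and [subst_fun_dom]
   below show that this is the usual description of F[G/v]. *)
Definition subst_fun (F G : formula) (v : nat) (p : position) : option label :=
  if [pick i : 'I_(size p).+1 | is_var_of v (F (take i p))] is Some i then
    if F (take i p) is Some (Pos _) then G (drop i p) else neg G (drop i p)
  else F p.

Lemma is_var_ofW v l : is_var_of v l -> is_var l.
Proof. by case: l => [[]|]. Qed.

Lemma is_var_dom l : is_var l -> l.
Proof. by case: l. Qed.

Lemma is_var_of_prefix (F : formula) v r q :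
  is_var_of v (F r) -> F (r ++ q) -> q = [::].
Proof.
move=> /is_var_ofW/formula_leaf[_ leafr]; case: q => // n q Fq.
by have /negP[] : ~~ dom F (r ++ n :: q) by apply: leafr; apply: sprefix_cat.
Qed.

Lemma subst_fun_var (F G : formula) v r q : is_var_of v (F r) ->
  subst_fun F G v (r ++ q) =
    if F r is Some (Pos _) then G q else neg G q.
Proof.
move=> vr; rewrite /subst_fun; case: pickP => [i vi|]; last first.
  have ltr : size r < (size (r ++ q)).+1 by rewrite ltnS size_cat leq_addr.
  by move=> /(_ (Ordinal ltr)); rewrite /= take_size_cat ?vr.
suff ir : i = size r :> nat by rewrite ir take_size_cat // drop_size_cat.
have li : i <= size (r ++ q) by rewrite -ltnS ltn_ord.
have Fi := is_var_dom (is_var_ofW vi); have Fr := is_var_dom (is_var_ofW vr).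
case: (leqP i (size r)) => [le_ir|lt_ri].
  have Er : r = take i (r ++ q) ++ drop i r.
    by rewrite takel_cat // cat_take_drop.
  have := @is_var_of_prefix F v (take i (r ++ q)) (drop i r) vi.
  rewrite -Er => /(_ Fr)/eqP; rewrite -size_eq0 size_drop subn_eq0 => le_ri.
  by apply/eqP; rewrite eqn_leq le_ir.
have Ei : take i (r ++ q) = r ++ take (i - size r) q.
  by rewrite take_cat ltnNge (ltnW lt_ri).
move: Fi; rewrite Ei => /(is_var_of_prefix vr) E0.
have /eqP := congr1 size Ei.
by rewrite E0 cats0 size_takel // => /eqP.
Qed.

Lemma subst_fun_pos (F G : formula) v r q :
  F r = Some (Pos v) -> subst_fun F G v (r ++ q) = G q.
Proof. by move=> Fr; rewrite subst_fun_var Fr //= eqxx. Qed.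

Lemma subst_fun_neg (F G : formula) v r q :
  F r = Some (Neg v) -> subst_fun F G v (r ++ q) = neg G q.
Proof. by move=> Fr; rewrite subst_fun_var Fr //= eqxx. Qed.

Lemma subst_fun_out (F G : formula) v p :
  dom F p -> ~~ is_var_of v (F p) -> subst_fun F G v p = F p.
Proof.
move=> Fp vp; rewrite /subst_fun; case: pickP => // i vi.
have := @is_var_of_prefix F v (take i p) (drop i p) vi.
rewrite cat_take_drop => /(_ Fp) E.
have Et : take i p = p by rewrite -[RHS](cat_take_drop i p) E cats0.
by move: vi; rewrite Et (negPf vp).
Qed.

Lemma subst_fun_dom (F G : formula) v p :
  subst_fun F G v p <->
  (dom F p /\ ~~ is_var_of v (F p)) \/
  (exists r q, [/\ p = r ++ q, is_var_of v (F r) & dom G q]).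
Proof.
split=> [|[[Fp vp]|[r [q [-> vr Gq]]]]]; last 2 first.
- by rewrite subst_fun_out.
- rewrite subst_fun_var //; case: (F r) => [[]|] //=; rewrite ?neg_fun_dom //.
rewrite /subst_fun; case: pickP => [i vi H|nv Fp].
  right; exists (take i p), (drop i p); split; rewrite ?cat_take_drop //.
  by move: H; rewrite /dom; case: (F _) => [[]|] //=; rewrite ?neg_fun_dom.
left; split=> //; have := nv ord_max.
by rewrite /= take_size => ->.
Qed.

Lemma cat_eq_split (r s q t : position) : r ++ s = q ++ t -> size r <= size q ->
  exists2 u, q = r ++ u & s = u ++ t.
Proof.
elim: r q => [|m r IHr] [|n q] //=; first by exists [::].
- by exists (n :: q).
by case=> -> /IHr H /H[u -> ->]; exists u.
Qed.

Lemma subst_fun_root F G v : subst_fun F G v [::].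
Proof.
apply/subst_fun_dom; case: (boolP (is_var_of v (F [::]))) => [v0|]; last first.
  by left; split=> //; apply: tree_root.
by right; exists [::], [::]; split=> //; apply: tree_root.
Qed.

Lemma subst_fun_closed F G v p q :
  subst_fun F G v p -> prefix q p -> subst_fun F G v q.
Proof.
move=> /subst_fun_dom Hp /prefixP[t Ep]; apply/subst_fun_dom.
have domF : dom F q ->
    (dom F q /\ ~~ is_var_of v (F q)) \/
    (exists r s, [/\ q = r ++ s, is_var_of v (F r) & dom G s]).
  move=> Fq; case: (boolP (is_var_of v (F q))) => [vq|]; last by left.
  by right; exists q, [::]; rewrite cats0; split=> //; apply: tree_root.
case: Hp => [[Fp _]|[r [s [Er vr Gs]]]].
  by apply: domF; apply: tree_closed Fp _; rewrite Ep prefix_prefix.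
have Fr : F r by apply/is_var_dom/is_var_ofW/vr.
have Ert : r ++ s = q ++ t by rewrite -Er.
case: (leqP (size q) (size r)) => [le_qr|/ltnW le_rq].
  apply: domF; apply: tree_closed Fr _.
  by have [u -> _] := cat_eq_split (esym Ert) le_qr; apply: prefix_prefix.
have [u Eq Es] := cat_eq_split Ert le_rq.
right; exists r, u; split=> //; apply: tree_closed Gs _.
by rewrite Es prefix_prefix.
Qed.

Definition subst_tree (F G : formula) (v : nat) : tree label :=
  Tree (subst_fun_root F G v) (@subst_fun_closed F G v).

Lemma subst_tree_leaf F G v p :
  is_var (subst_tree F G v p) -> leaf (subst_tree F G v) p.
Proof.
move=> vp; split=> [|_ [t t0 ->]]; first by apply: is_var_dom.
apply/negP => /subst_fun_dom Hpt.
have /subst_fun_dom := is_var_dom vp.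
case=> [[Fp nv]|[r [q [Ep vr Gq]]]].
  move: vp; rewrite /= subst_fun_out // => /formula_leaf[_ leafp].
  case: Hpt => [[Fpt _]|[r [q [Er vr Gq]]]].
    by have /negP[] := leafp (p ++ t) (sprefix_cat _ t0).
  have Fr : F r by apply/is_var_dom/is_var_ofW/vr.
  case: (leqP (size r) (size p)) => [le_rp|lt_pr].
    have [u Ep _] := cat_eq_split (esym Er) le_rp.
    move: Fp nv; rewrite Ep /dom => /(is_var_of_prefix vr) ->.
    by rewrite cats0 vr.
  have [u Erp _] := cat_eq_split Er (ltnW lt_pr).
  have u0 : u <> [::] by move=> u0; move: lt_pr; rewrite Erp u0 cats0 ltnn.
  by have /negP[] : ~~ dom F r by rewrite Erp; apply/leafp/sprefix_cat.
have: dom G (q ++ t).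
  move: Hpt => /subst_fun_dom; rewrite Ep -catA subst_fun_var // /dom.
  by case: (F r) => [[]|] //=; rewrite ?neg_fun_dom.
move: vp; rewrite Ep /= subst_fun_var //.
have leafG (H : formula) : is_var (H q) -> ~ dom H (q ++ t).
  by case/formula_leaf=> _ /(_ (q ++ t) (sprefix_cat _ t0))/negP.
have := @leafG (neg G); rewrite /dom /= neg_fun_dom.
by move: (leafG G); case: (F r) => [[]|] //= *; eauto.
Qed.

Definition subst (F G : formula) (v : nat) : formula :=
  Formula (@subst_tree_leaf F G v).

(* The positive atom on the left of a recursive equation is given by its
   index [v]. *)
Definition recursive_equation (v : nat) (F : formula) : Prop :=
  compound F /\ exists2 p : position, dom F p & is_var_of v (F p).

Definition solution (v : nat) (F G : formula) : Prop := G = subst F G v.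

(* Main.v *)
(** For compound [F] every occurrence of [v] in [F] lies at a position of
    positive length, so G |-> F[G/v] is a contraction for the metric in which
    two formulas are close when they agree on all short positions. Its unique
    fixed point is the limit of the iterates from an arbitrary formula. If [r]
    is an occurrence of [v] in [F], the solution repeats itself (up to negation)
    below [r], hence contains the infinite branch [r ++ r ++ r ++ ...]. *)

Require Import Defs.
From mathcomp Require Import all_boot.
From Stdlib Require Import FunctionalExtensionality ProofIrrelevance.

(** [solution] asks for Leibniz equality of records that carry proofs, hence the two axioms. *)
Lemma tree_ext (L : Type) (T U : tree L) : T =1 U -> T = U.
Proof.
case: T U => [f f0 fc] [g g0 gc] /= /functional_extensionality fg.
by case: _ / fg in g0 gc *; congr Tree; apply: proof_irrelevance.
Qed.

Lemma formula_ext (F G : formula) : F =1 G -> F = G.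
Proof.
case: F G => [T lT] [U lU] /= /tree_ext TU.
by case: _ / TU in lU *; congr Formula; apply: proof_irrelevance.
Qed.

Definition agree_below (n : nat) (F G : formula) : Prop :=
  forall p, size p < n -> F p = G p.

Lemma subst_contract (v : nat) (F G H : formula) n : compound F ->
  agree_below n G H -> agree_below n.+1 (subst F G v) (subst F H v).
Proof.
move=> cF GH p; rewrite ltnS => le_pn; rewrite /= /subst_fun.
case: pickP => // i vi.
(* If [i] or the length of [p] were zero, the variable would sit at the root of [F]. So [drop i p],
   where [G] and [H] are read, is strictly shorter than [p]. *)
have [i0 p0] : 0 < i /\ 0 < size p.
  split; rewrite lt0n; apply/negP => /eqP E; case: cF;
    apply: (@is_var_ofW v); first by move: vi; rewrite E take0.
  by move: (nat_of_ord i) vi => k; rewrite (size0nil E).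
have lt_dn : size (drop i p) < n.
  by rewrite size_drop (leq_trans _ le_pn) // ltn_subrL i0.
by rewrite /= /neg_fun GH.
Qed.

Lemma solution_unique (v : nat) (F G H : formula) : compound F ->
  solution v F G -> solution v F H -> G = H.
Proof.
move=> cF sG sH; apply: formula_ext => p.
suff GH n : agree_below n G H by apply: (GH (size p).+1).
by elim: n => // n IHn; rewrite sG sH; apply: subst_contract.
Qed.

Definition approx (v : nat) (F : formula) (n : nat) : formula :=
  iter n (fun G => subst F G v) F.

Lemma approx_agree (v : nat) (F : formula) m n : compound F -> m <= n ->
  agree_below m (approx v F m) (approx v F n).
Proof.
move=> cF; elim: m n => // m IHm [//|n] le_mn.
by apply: subst_contract; last exact: IHm.
Qed.

(** Stage [n] is final only at lengths strictly below [n], hence the successor. *)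
Definition limit_fun (v : nat) (F : formula) (p : position) : option label :=
  approx v F (size p).+1 p.

Lemma limit_funE (v : nat) (F : formula) n p : compound F -> size p < n ->
  limit_fun v F p = approx v F n p.
Proof. by move=> cF lt_pn; apply: (approx_agree _ _ (size p).+1). Qed.

Lemma limit_fun_root (v : nat) (F : formula) : limit_fun v F [::].
Proof. exact: tree_root. Qed.

Lemma limit_fun_closed (v : nat) (F : formula) : compound F ->
  forall p q, limit_fun v F p -> prefix q p -> limit_fun v F q.
Proof.
move=> cF p q Gp qp; rewrite (limit_funE _ _ (size p).+1) //.
  exact: tree_closed Gp qp.
by rewrite ltnS size_prefix.
Qed.

Definition limit_tree (v : nat) (F : formula) (cF : compound F) : tree label :=
  Tree (limit_fun_root v F) (limit_fun_closed v F cF).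

Lemma limit_tree_leaf (v : nat) (F : formula) (cF : compound F) p :
  is_var (limit_tree v F cF p) -> leaf (limit_tree v F cF) p.
Proof.
move=> vp; split=> [|q pq]; first exact: is_var_dom.
have le_pq : size p <= size q by case: pq => t _ ->; rewrite size_cat leq_addr.
(* This one approximation is already final at both [p] and [q]. *)
have /formula_leaf[_ leafp] : is_var (approx v F (size q).+1 p).
  by rewrite -limit_funE.
exact: leafp.
Qed.

Definition limit (v : nat) (F : formula) (cF : compound F) : formula :=
  Formula (@limit_tree_leaf v F cF).

Lemma limit_solution (v : nat) (F : formula) (cF : compound F) :
  solution v F (limit v F cF).
Proof.
apply: formula_ext => p.
have agreeG : agree_below (size p) (approx v F (size p)) (limit v F cF).
  by move=> q lt_qp; rewrite /= (limit_funE _ _ (size p)).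
(* By conversion, the limit at [p] is [F] with approximation [size p] substituted, read at [p]. *)
exact: (subst_contract v F _ _ _ cF agreeG).
Qed.

Lemma solution_ill_founded (v : nat) (F G : formula) :
  recursive_equation v F -> solution v F G -> ill_founded G.
Proof.
case=> cF [r _ vr] sG; exists (fun n => iter n (cat r) [::]) => n.
  (* Below [r] the solution is a copy of [G] or of its negation, and these have the same domain. *)
  elim: n => [|n IHn]; first exact: tree_root.
  by rewrite /dom sG; apply/subst_fun_dom; right; exists r, (iter n (cat r) [::]).
exists r => [r0|]; first by apply/cF/(@is_var_ofW v); rewrite r0 in vr.
(* The iterates prepend [r], whereas an extension appends it; powers of [r] commute with [r]. *)
by elim: n => [|n IHn]; rewrite /= ?cats0 // -catA -IHn.
Qed.

Theorem mainTheorem1 (v : nat) (F : formula) :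
  recursive_equation v F ->
  exists G : formula, unique (solution v F) G /\ ill_founded G.
Proof.
move=> eqF; have [cF _] := eqF; have sG := limit_solution v F cF.
exists (limit v F cF); split; last exact: solution_ill_founded eqF sG.
by split=> // H; apply: solution_unique.
Qed.
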